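(* Let $(\mathcal{A},\varphi)$ be a noncommutative probability space and let $\mathcal{E}=(\mathcal{U},\tilde\varphi,\mathcal{J})$ be a noncrossing exchangeability system for $(\mathcal{A},\varphi)$ whose state $\tilde\varphi$ is faithful and which satisfies the extended weak singleton condition. Then $\mathcal{E}$ can be embedded into a $\mathcal{B}$-valued exchangeability system $(\tilde{\mathcal{U}},\psi,\mathcal{J})$, with $\psi:\tilde{\mathcal{U}}\to\mathcal{B}$ a conditional expectation onto a subalgebra $\mathcal{B}\subseteq\tilde{\mathcal{U}}$, such that the interchangeable algebras $\mathcal{A}_i$ are free with amalgamation over $\mathcal{B}$ and interchangeable with respect to $\psi$.
   Context: All algebras are unital complex $C^*$- or pre-$C^*$-algebras. A noncommutative probability space is a pair $(\mathcal{A},\varphi)$ of such an algebra and a state $\varphi$ on it. Exchangeability system. An exchangeability system $\mathcal{E}=(\mathcal{U},\tilde\varphi,\mathcal{J})$ for $(\mathcal{A},\varphi)$ consists of a noncommutative probability space $(\mathcal{U},\tilde\varphi)$ and an infinite family $\mathcal{J}=(\iota_k)_{k\in\mathbf{N}}$ of state-preserving embeddings ($*$-homomorphisms with $\tilde\varphi\circ\iota_k=\varphi$) $\iota_k:\mathcal{A}\to\mathcal{A}_k\subseteq\mathcal{U}$, written $X\mapsto X^{(k)}$, such that for all $n$, $X_1,\dots,X_n\in\mathcal{A}$, $h:[n]\to\mathbf{N}$ (where $[n]=\{1,\dots,n\}$) and $\sigma\in\mathfrak{S}_\infty$ (permutations of $\mathbf{N}$) $$\tilde\varphi(X_1^{(h(1))}\cdots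 X_n^{(h(n))})=\tilde\varphi(X_1^{(\sigma(h(1)))}\cdots X_n^{(\sigma(h(n)))}).$$ It is assumed that $\mathcal{U}$ is generated by the algebras $\mathcal{A}_k$ and that the action $\sigma(X^{(k)})=X^{(\sigma(k))}$ of $\mathfrak{S}_\infty$ extends to all of $\mathcal{U}$ leaving $\tilde\varphi$ invariant. Cumulants. $\Pi_n$ is the lattice of set partitions of $[n]$ ($\pi\le\sigma$ means $\pi$ is finer than $\sigma$), with Möbius function $\mu$. For $\pi\in\Pi_n$, $\varphi_\pi(X_1,\dots,X_n)=\tilde\varphi(X_1^{(\pi(1))}\cdots X_n^{(\pi(n))})$, where $\pi(i)$ is the number of the block of $\pi$ containing $i$ (the numbering of the blocks is irrelevant), and $K^{\mathcal{E}}_\pi(X_1,\dots,X_n)=\sum_{\sigma\le\pi}\varphi_\sigma(X_1,\dots,X_n)\,\mu(\sigma,\pi)$. A partition is noncrossing if there are no $i<j<k<l$ with $i\sim k$, $j\sim l$, $i\not\sim j$. $\mathcal{E}$ is a noncrossing exchangeability system if $K^{\mathcal{E}}_\pi(X_1,\dots,X_n)=0$ for all $n$, all $X_i\in\mathcal{A}$ and all $\pi\in\Pi_n$ that are not noncrossing. Extended weak singleton condition. For $I\subseteq\mathbf{N}$ let $\mathcal{A}_I$ be the algebra generated by $(\mathcal{A}_i)_{i\in I}$. Given a sequence $(I_j)_{j\in\mathbf{N}}$ of mutually disjoint subsets of $\mathbf{N}$ of the same cardinality as $I$ and bijections $I\to I_j$, let $W\mapsto W^{(I_j)}$ be the induced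 permutation isomorphism $\mathcal{A}_I\to\mathcal{A}_{I_j}$. $\mathcal{E}$ satisfies the extended weak singleton condition if for every finite $I\subseteq\mathbf{N}$ and all $W_1,\dots,W_n\in\mathcal{A}_I$ (polynomials in elements of the $\mathcal{A}_i$, $i\in I$) one has $\tilde\varphi(W_1^{(I_{i_1})}\cdots W_n^{(I_{i_n})})=0$ whenever, for some $j$, the index $i_j$ appears only once among $i_1,\dots,i_n$ and $\tilde\varphi((W_j^{(I_1)})^*W_j^{(I_2)})=0$. Operator-valued notions. A conditional expectation from a unital algebra onto a unital subalgebra $\mathcal{B}$ is a unital positive map $\psi$ onto $\mathcal{B}$ with $\psi(BXB')=B\psi(X)B'$ for $B,B'\in\mathcal{B}$. ''$\mathcal{E}$ can be embedded into a $\mathcal{B}$-valued exchangeability system $(\tilde{\mathcal{U}},\psi,\mathcal{J})$'' means: there are an algebra $\tilde{\mathcal{U}}$, a conditional expectation $\psi:\tilde{\mathcal{U}}\to\mathcal{B}$ onto a subalgebra $\mathcal{B}$, an injective $*$-homomorphism of $\mathcal{U}$ into $\tilde{\mathcal{U}}$ (through which $\mathcal{U}$, the $\mathcal{A}_k$ and the elements $X^{(k)}$ are regarded as contained in $\tilde{\mathcal{U}}$), and a state on $\mathcal{B}$ whose composition with $\psi$ restricts to $\tilde\varphi$ on $\mathcal{U}$. The algebras $\mathcal{A}_i$ are interchangeable with respect to $\psi$ if $\psi(X_1^{(h(1))}\cdots X_n^{(h(n))})=\psi(X_1^{(\sigma(h(1)))}\cdots X_n^{(\sigma(h(n)))})$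 for all $X_j\in\mathcal{A}$, $h:[n]\to\mathbf{N}$, $\sigma\in\mathfrak{S}_\infty$. They are free with amalgamation over $\mathcal{B}$ if $\psi(X_1^{(h(1))}\cdots X_n^{(h(n))})=0$ whenever $X_j\in\mathcal{A}$ with $\psi(X_j^{(1)})=0$ for all $j$ and $h(j)\neq h(j+1)$ for $1\le j\le n-1$. *)

(* Defs.v *)
(* MathComp with MathComp-Analysis; the complex numbers are [R[i]] for
   [R : realType]. *)
From HB Require Import structures.
From mathcomp Require Import all_boot all_order all_algebra.
From mathcomp Require Export complex.
From mathcomp Require Import all_classical all_reals all_analysis.

Set Implicit Arguments.
Unset Strict Implicit.
Unset Printing Implicit Defensive.

Import Order.TTheory GRing.Theory Num.Theory.

Local Open Scope classical_set_scope.
Local Open Scope ring_scope.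

(** * Pre-C*-algebras *)

(* The norm need not be complete, so this covers C*-algebras as well. It takes its
   values in [C], as is usual for [normedModType C]; that structure itself
   is not used since its class cannot be joined with [GRing.Algebra]. *)
HB.mixin Record isPreCstar (C : numClosedFieldType) A of GRing.Algebra C A := {
  star : A -> A ;
  cnorm : A -> C ;
  starK : involutive star ;
  starD : {morph star : x y / x + y} ;
  starZ : forall (c : C) (x : A), star (c *: x) = c^* *: star x ;
  starM : forall x y : A, star (x * y) = star y * star x ;
  cnorm_eq0 : forall x : A, cnorm x = 0 -> x = 0 ;
  cnormD : forall x y : A, cnorm (x + y) <= cnorm x + cnorm y ;
  cnormZ : forall (c : C) (x : A), cnorm (c *: x) = `|c| * cnorm x ;
  cnormM : forall x y : A, cnorm (x * y) <= cnorm x * cnorm y ;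
  cnorm_star : forall x : A, cnorm (star x * x) = cnorm x ^+ 2
}.

#[short(type="preCstarType")]
HB.structure Definition PreCstar (C : numClosedFieldType) :=
  {A of GRing.Algebra C A & isPreCstar C A}.

Definition norm_closure (C : numClosedFieldType) (A : preCstarType C)
    (S : set A) : set A :=
  [set x | forall e : C, 0 < e -> exists2 y, S y & cnorm (x - y) < e].

Definition star_subalgebra (C : numClosedFieldType) (A : preCstarType C)
    (S : set A) : Prop :=
  [/\ S 1,
      forall (c : C) x y, S x -> S y -> S (c *: x + y),
      forall x y, S x -> S y -> S (x * y)
    & forall x, S x -> S (star x)].

(* The elements of the *-subalgebra [S] that are positive in its completion. If
   [S] is complete these are just the elements [star x * x] with [x] in [S]. *)
Definition positive_in (C : numClosedFieldType) (A : preCstarType C)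
    (S : set A) : set A :=
  S `&` norm_closure [set star x * x | x in S].

(* [f] restricts to a state on [S]; its values outside [S] are irrelevant.
   Positivity on the whole of [positive_in S] makes [f] bounded on [S] even if
   [S] is not complete. *)
Definition state_on (C : numClosedFieldType) (A : preCstarType C) (S : set A)
    (f : A -> C) : Prop :=
  [/\ forall (c : C) x y, S x -> S y -> f (c *: x + y) = c * f x + f y,
      f 1 = 1
    & forall x, positive_in S x -> 0 <= f x].

Definition state (C : numClosedFieldType) (A : preCstarType C) (f : A -> C) :=
  state_on setT f.

Definition faithful (C : numClosedFieldType) (A : preCstarType C)
    (f : A -> C) : Prop :=
  forall x, f (star x * x) = 0 -> x = 0.

(** * Set partitions and their Moebius function *)

Section Moebius.
Context {disp : Order.disp_t} {T : finPOrderType disp}.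

(* [mu x x = 1] and [mu x y = - \sum_(x <= z < y) mu x z] for [x < y]; see
   [moebius_refl] and [moebius_sum]. The fuel [n] bounds the length of chains. *)
Fixpoint moebius_rec (n : nat) (x y : T) : int :=
  if n is m.+1 then
    if x == y then 1
    else - \sum_(z : T | (x <= z)%O && (z < y)%O) moebius_rec m x z
  else 0.

Definition moebius (x y : T) : int := moebius_rec #|T| x y.

Let below (y : T) := #|[pred z | (z < y)%O]|.

Let below_lt (y z : T) : (z < y)%O -> (below z < below y)%N.
Proof.
move=> zy; apply: proper_card; apply/properP; split.
  by apply/fintype.subsetP => t; rewrite !inE => /lt_trans; apply.
by exists z; rewrite !inE ?zy// ltxx.
Qed.

Let moebius_rec_fuel m n (x y : T) : (below y < m)%N -> (below y < n)%N ->
  moebius_rec m x y = moebius_rec n x y.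
Proof.
elim: m n y => [//|m IH] [//|n] y ym yn /=.
case: eqP => // _; congr (- _); apply: eq_bigr => z /andP[_ zy].
by apply: IH; apply: leq_trans (below_lt zy) _.
Qed.

Let below_card y : (below y < #|T|)%N.
Proof.
apply: proper_card; apply/properP; split; first exact/fintype.subsetP.
by exists y; rewrite !inE// ltxx.
Qed.

Lemma moebius_refl x : moebius x x = 1.
Proof.
by rewrite /moebius; case: #|T| (below_card x) => [//|n] _ /=; rewrite eqxx.
Qed.

Lemma moebius_sum (x y : T) : (x < y)%O ->
  \sum_(z : T | (x <= z)%O && (z <= y)%O) moebius x z = 0.
Proof.
move=> xy; rewrite (bigD1 y)/=; last by rewrite (ltW xy) lexx.
rewrite {1}/moebius; case E : #|T| (below_card y) => [//|n] yn /=.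
rewrite (lt_eqF xy) addrC; apply/eqP; rewrite subr_eq0; apply/eqP.
apply: eq_big => [z|z]; first by rewrite lt_neqAle andbA andbAC -!andbA.
move=> /andP[/andP[_ zy] zNy]; have {}zy : (z < y)%O by rewrite lt_neqAle zNy.
have zn : (below z < n)%N by apply: leq_trans (below_lt zy) _.
by apply: moebius_rec_fuel => //; rewrite E; apply: leq_trans zn _.
Qed.

End Moebius.

Record set_partition (n : nat) := SetPartition {
  blocks :> {set {set 'I_n}} ;
  _ : finset.partition blocks [set: 'I_n]%SET
}.

HB.instance Definition _ n := [isSub for @blocks n].
HB.instance Definition _ n := [Finite of set_partition n by <:].

Section SetPartition.
Variable n : nat.
Implicit Types p q : set_partition n.

Definition block p (i : 'I_n) : {set 'I_n} := finset.pblock p i.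

(* The number of the block of [p] containing [i], for some enumeration of the
   blocks. *)
Definition block_number p (i : 'I_n) : nat := index (block p i) (enum (blocks p)).

Definition finer p q : bool :=
  [forall B in blocks p, exists D in blocks q, B \subset D].

Let finer_refl : reflexive finer.
Proof.
by move=> p; apply/forall_inP => B Bp; apply/exists_inP; exists B.
Qed.

Let finer_trans : transitive finer.
Proof.
move=> q p r /forall_inP pq /forall_inP qr; apply/forall_inP => B /pq.
case/exists_inP => D /qr /exists_inP[F Fr DF] BD.
by apply/exists_inP; exists F => //; apply: fintype.subset_trans DF.
Qed.

Let finer_sub p q : finer p q -> finer q p -> blocks p \subset blocks q.
Proof.
move=> /forall_inP pq /forall_inP qp; apply/fintype.subsetP => B Bp.
have /exists_inP[D Dq BD] := pq _ Bp; have /exists_inP[F Fp DF] := qp _ Dq.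
have /and3P[_ /finset.trivIsetP tp p0] := valP p.
have [BF|/tp-/(_ Bp Fp)] := eqVneq B F.
  by suff -> : B = D by []; apply/eqP; rewrite finset.eqEsubset BD BF.
rewrite -finset.setI_eq0 (finset.setIidPl (fintype.subset_trans BD DF)) => /eqP B0.
by rewrite B0 in Bp; rewrite Bp in p0.
Qed.

Let finer_anti : antisymmetric finer.
Proof.
move=> p q /andP[pq qp]; apply/val_inj/eqP.
by rewrite finset.eqEsubset !finer_sub.
Qed.

HB.instance Definition _ := Order.Le_isPOrder.Build (Order.Disp tt tt)
  (set_partition n) finer_refl finer_anti finer_trans.

Definition noncrossing p : Prop :=
  ~ exists i j k l : 'I_n,
      [/\ (i < j < k)%N && (k < l)%N, block p i = block p k,
          block p j = block p l & block p i <> block p j].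

End SetPartition.

(** * Exchangeability systems *)

(* Permutations of [nat] are functions satisfying [bijective]. *)
Record exchangeability_system (C : numClosedFieldType) (A : preCstarType C)
    (phi : A -> C) := ExchangeabilitySystem {
  exch_alg :> preCstarType C ;
  exch_state : exch_alg -> C ;
  exch_emb : nat -> {lrmorphism A -> exch_alg} ;
  (* only meaningful on bijections *)
  exch_act : (nat -> nat) -> {lrmorphism exch_alg -> exch_alg} ;
  exch_state_is_state : state exch_state ;
  exch_emb_star : forall k x, exch_emb k (star x) = star (exch_emb k x) ;
  exch_emb_state : forall k x, exch_state (exch_emb k x) = phi x ;
  exch_exchangeable :
    forall (n : nat) (X : 'I_n -> A) (h : 'I_n -> nat) (s : nat -> nat),
      bijective s ->
      exch_state (\prod_(i < n) exch_emb (h i) (X i)) =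
      exch_state (\prod_(i < n) exch_emb (s (h i)) (X i)) ;
  (* Generation is topological, as appropriate if [exch_alg] is complete;
     algebraic generation is a special case. *)
  exch_generated :
    norm_closure (smallest (@star_subalgebra C exch_alg)
               (\bigcup_k range (exch_emb k))) = setT ;
  exch_act_star : forall s, bijective s ->
    forall u, exch_act s (star u) = star (exch_act s u) ;
  exch_act1 : forall u, exch_act id u = u ;
  exch_actM : forall s t, bijective s -> bijective t ->
    forall u, exch_act (s \o t) u = exch_act s (exch_act t u) ;
  exch_act_emb : forall s, bijective s ->
    forall k x, exch_act s (exch_emb k x) = exch_emb (s k) x ;
  exch_act_state : forall s, bijective s ->
    forall u, exch_state (exch_act s u) = exch_state u
}.

Section ExchangeabilitySystem.
Context {C : numClosedFieldType} {A : preCstarType C} {phi : A -> C}.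
Variable E : exchangeability_system phi.

Definition exch_phi (n : nat) (p : set_partition n) (X : 'I_n -> A) : C :=
  exch_state (\prod_(i < n) exch_emb E (block_number p i) (X i)).

Definition exch_cumulant (n : nat) (p : set_partition n) (X : 'I_n -> A) : C :=
  \sum_(q : set_partition n | (q <= p)%O) exch_phi q X * (moebius q p)%:~R.

Definition noncrossing_system : Prop :=
  forall (n : nat) (X : 'I_n -> A) (p : set_partition n),
    ~ noncrossing p -> exch_cumulant p X = 0.

Definition exch_subalg (I : set nat) : set E :=
  smallest (@star_subalgebra C E) (\bigcup_(k in I) range (exch_emb E k)).

(* The bijection from [I] to [J j] is given as the restriction of a permutation
   [s j] of [nat]; every bijection between finite sets arises in this way, and
   [exch_act E (s j)] restricts to the induced isomorphism from [exch_subalg I]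
   to [exch_subalg (J j)]. As [nat] starts at 0, the copies of [W j] numbered 1
   and 2 in the literature are those of [s 0] and [s 1]. *)
Definition extended_weak_singleton : Prop :=
  forall (I : set nat) (J : nat -> set nat) (s : nat -> nat -> nat),
    finite_set I -> trivIset setT J ->
    (forall j, bijective (s j)) -> (forall j, set_bij I (J j) (s j)) ->
  forall (n : nat) (W : 'I_n -> E) (c : 'I_n -> nat),
    (forall k, exch_subalg I (W k)) ->
  forall j : 'I_n,
    (forall k, k != j -> c k != c j) ->
    exch_state (star (exch_act E (s 0%N) (W j)) * exch_act E (s 1%N) (W j)) = 0 ->
    exch_state (\prod_(k < n) exch_act E (s (c k)) (W k)) = 0.

End ExchangeabilitySystem.

(** * Operator-valued notions *)

Section OperatorValued.
Context {C : numClosedFieldType} {U : preCstarType C}.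

Definition conditional_expectation (B : set U) (psi : {linear U -> U}) : Prop :=
  [/\ star_subalgebra B,
      range psi = B,
      psi 1 = 1,
      forall x, positive_in setT x -> positive_in B (psi x)
    & forall b x b', B b -> B b' -> psi (b * x * b') = b * psi x * b'].

Variables (A : preCstarType C) (iota : nat -> A -> U) (psi : U -> U).

Definition interchangeable : Prop :=
  forall (n : nat) (X : 'I_n -> A) (h : 'I_n -> nat) (s : nat -> nat),
    bijective s ->
    psi (\prod_(i < n) iota (h i) (X i)) =
    psi (\prod_(i < n) iota (s (h i)) (X i)).

(* Freeness with amalgamation over the range of [psi]. The products must be
   nonempty, and the first copy of [A] is numbered 0. *)
Definition free_with_amalgamation : Prop :=
  forall (n : nat) (X : 'I_n -> A) (h : 'I_n -> nat),
    (0 < n)%N ->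
    (forall i, psi (iota 0%N (X i)) = 0) ->
    (forall i j : 'I_n, j = i.+1 :> nat -> h i <> h j) ->
    psi (\prod_(i < n) iota (h i) (X i)) = 0.

End OperatorValued.

(* Main.v *)
From HB Require Import structures.
Require Import Defs.
From mathcomp Require Import all_boot all_order all_algebra.
From mathcomp Require Import complex ring zify.
From mathcomp Require Import all_classical all_reals all_analysis.

Set Implicit Arguments.
Unset Strict Implicit.
Unset Printing Implicit Defensive.

Import Order.TTheory GRing.Theory Num.Theory.

Local Open Scope classical_set_scope.
Local Open Scope ring_scope.

(** The subalgebra [B] can be taken commutative: the extension is a direct
    integral of scalar states. Let [I] be the set of all states [w] on the given
    algebra [E] which are exchangeable and vanish on every alternating word whose
    letters are null, where [X] is null when the moment of [star X] in one copy
    and [X] in another copy vanishes. Put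

      - [Ut] := the bounded families of elements of [E] indexed by [I],
      - [B] := the bounded families of scalars,
      - [psi f] := the family of the numbers [w (f w)],
      - [j u] := the constant family [u],

    and let [beta] be the evaluation at the original state. States on pre-C*-
    algebras are bounded ([state_bound]), so [psi] is defined; as [B] is the
    product of copies of the scalars and [psi] acts coordinatewise by a state, it
    is a conditional expectation ([conditional_expectation_states]).
    Interchangeability holds in every coordinate. Freeness holds as soon as
    letters killed by all of [I] are null.

    Two facts make [I] rich enough. First, the original state [exch_state]
    belongs to [I], by the interplay of the two hypotheses on cumulants and
    singletons ([separated_moment]): a moment of crossing type is a combination of moments
    of strictly finer types because its cumulant vanishes, whereas an alternating
    noncrossing type has a singleton, which carries a null letter. Second, for
    each [y] the functionals [u |-> exch_state (star y_m * u * y_m)], with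
    [y_m] the [m]-th copy of [y], stabilize on a dense subset, hence converge
    to a state up to normalization. Exchangeability passes to this limit, and so does the
    vanishing on alternating null words, since a word surrounded by letters from
    a remote copy is covered by the same combinatorial argument
    ([asymptotic_state]). When all these limits vanish at a copy of [X],
    polarization in [y] gives the vanishing of the mixed moments of [star y] and
    [X], in particular for [y := X]: thus [X] is null ([null_of_admissible]). *)

(** * Norms and states on pre-C*-algebras *)

Section CstarNorm.
Context {C : numClosedFieldType} {U : preCstarType C}.
Implicit Types x y t : U.

Lemma cnorm0 : cnorm (0 : U) = 0.
Proof. by rewrite -(scale0r (0 : U)) cnormZ normr0 mul0r. Qed.

Lemma cnormN x : cnorm (- x) = cnorm x.
Proof. by rewrite -scaleN1r cnormZ normrN normr1 mul1r. Qed.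

Lemma cnorm_ge0 x : 0 <= cnorm x.
Proof.
have := cnormD x (- x); rewrite subrr cnorm0 cnormN -mulr2n.
by rewrite pmulrn_lge0.
Qed.

Lemma cnorm_star_eq x : cnorm (star x) = cnorm x.
Proof.
have le_star y : cnorm y <= cnorm (star y).
  have [->|y0] := eqVneq (cnorm y) 0; first exact: cnorm_ge0.
  have yp : 0 < cnorm y by rewrite lt0r y0 cnorm_ge0.
  by rewrite -(ler_pM2r yp) -expr2 -cnorm_star cnormM.
by apply: le_anti; rewrite le_star -[X in _ <= cnorm X]starK le_star.
Qed.

Lemma star0 : star (0 : U) = 0.
Proof. by rewrite -(scale0r (0 : U)) starZ conjC0 !scale0r. Qed.

Lemma starN x : star (- x) = - star x.
Proof. by rewrite -scaleN1r starZ rmorphN rmorph1 scaleN1r. Qed.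

Lemma star1 : star (1 : U) = 1.
Proof. by rewrite -[LHS]mulr1 -[X in _ * X]starK -starM mulr1 starK. Qed.

Lemma cnorm1 : cnorm (1 : U) = 1.
Proof.
have n1 : cnorm (1 : U) != 0 by apply/eqP => /cnorm_eq0/eqP; rewrite oner_eq0.
by apply: (mulfI n1); rewrite mulr1 -expr2 -cnorm_star star1 mulr1.
Qed.

Lemma positive_square x : positive_in setT (star x * x).
Proof.
split=> // e e0; exists (star x * x); first by exists x.
by rewrite subrr cnorm0.
Qed.

(** Compressions [x |-> star y * x * y] are norm continuous and map squares to
    squares. *)
Lemma positive_compress y x :
  positive_in setT x -> positive_in setT (star y * x * y).
Proof.
move=> [_ x0]; split=> // e e0.
have M0 : 0 < cnorm (star y) * cnorm y + 1.
  by rewrite ltr_wpDl// mulr_ge0// cnorm_ge0.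
have [_ [z _ <-] xz] := x0 _ (divr_gt0 e0 M0).
exists (star (z * y) * (z * y)); first by exists (z * y).
have -> : star y * x * y - star (z * y) * (z * y) =
          star y * (x - star z * z) * y.
  by rewrite starM mulrBr mulrBl !mulrA.
apply: (le_lt_trans (cnormM _ _)).
apply: (@le_lt_trans _ _ ((cnorm (star y) * cnorm (x - star z * z)) * cnorm y)).
  by apply: ler_wpM2r (cnorm_ge0 _) _ _ (cnormM _ _).
rewrite mulrAC; move: xz; rewrite ltr_pdivlMr// => xz.
apply: le_lt_trans xz; rewrite mulrC ler_wpM2l ?cnorm_ge0//.
by rewrite lerDl.
Qed.

(** For [t] of norm below 1 the iterates converge to [1 - sqrt (1 - t)]. *)
Fixpoint sqrt_iter t (n : nat) : U :=
  if n is m.+1 then 2%:R^-1 *: (t + sqrt_iter t m * sqrt_iter t m) else 0.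

Lemma star_sqrt_iter t n : star t = t -> star (sqrt_iter t n) = sqrt_iter t n.
Proof.
move=> ts; elim: n => [|n IH] /=; first exact: star0.
by rewrite starZ starD starM IH ts fmorphV rmorph_nat.
Qed.

Lemma cnorm_sqrt_iter t n : cnorm t <= 1 -> cnorm (sqrt_iter t n) <= cnorm t.
Proof.
move=> t1; elim: n => [|n IH] /=; first by rewrite cnorm0 cnorm_ge0.
rewrite cnormZ ger0_norm ?invr_ge0// mulrC ler_pdivrMr// mulr_natr mulr2n.
apply: le_trans (cnormD _ _) _; rewrite lerD2l.
apply: le_trans (cnormM _ _) _; rewrite -[leRHS]mul1r.
apply: ler_pM; rewrite ?cnorm_ge0//.
exact: le_trans IH t1.
Qed.

(** The recursion is a contraction, because
    [a ^+ 2 - b ^+ 2 = a * (a - b) + (a - b) * b] whether or not [a] and [b]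
    commute. *)
Lemma cnorm_sqrt_iterS t n : cnorm t <= 1 ->
  cnorm (sqrt_iter t n.+1 - sqrt_iter t n) <= cnorm t ^+ n.+1.
Proof.
move=> t1; elim: n => [|n IH].
  by rewrite /= subr0 mulr0 addr0 cnormZ ger0_norm ?invr_ge0// expr1
    mulrC ler_pdivrMr// mulr_natr mulr2n lerDl cnorm_ge0.
set a := sqrt_iter t n.+1 in IH *; set b := sqrt_iter t n in IH *.
have -> : sqrt_iter t n.+2 - a = 2%:R^-1 *: (a * (a - b) + (a - b) * b).
  rewrite [in LHS]/a /= -/a -/b -scalerBr mulrBr mulrBl addrA subrK.
  by congr (_ *: _); rewrite opprD addrACA subrr add0r.
rewrite cnormZ ger0_norm ?invr_ge0// mulrC ler_pdivrMr// mulr_natr mulr2n.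
apply: le_trans (cnormD _ _) _; apply: lerD.
  rewrite exprS; apply: le_trans (cnormM _ _) _.
  by apply: ler_pM; rewrite ?cnorm_ge0 ?cnorm_sqrt_iter.
rewrite exprSr; apply: le_trans (cnormM _ _) _.
by apply: ler_pM; rewrite ?cnorm_ge0 ?cnorm_sqrt_iter.
Qed.

End CstarNorm.

Section StateBasics.
Context {C : numClosedFieldType} {U : preCstarType C} (f : U -> C).
Hypothesis fstate : state f.

Lemma state_lin c x y : f (c *: x + y) = c * f x + f y.
Proof. by case: fstate => /(_ c x y I I). Qed.

Lemma stateD x y : f (x + y) = f x + f y.
Proof. by rewrite -[x]scale1r state_lin mul1r scale1r. Qed.

Lemma state0 : f 0 = 0.
Proof. by apply: (addIr (f 0)); rewrite -stateD !add0r. Qed.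

Lemma stateZ c x : f (c *: x) = c * f x.
Proof. by rewrite -[c *: x]addr0 state_lin state0 addr0. Qed.

Lemma stateN x : f (- x) = - f x.
Proof. by rewrite -scaleN1r stateZ mulN1r. Qed.

Lemma stateB x y : f (x - y) = f x - f y.
Proof. by rewrite stateD stateN. Qed.

Lemma state1 : f 1 = 1.
Proof. by case: fstate. Qed.

Lemma state_pos x : positive_in setT x -> 0 <= f x.
Proof. by case: fstate => _ _; apply. Qed.

Lemma state_square x : 0 <= f (star x * x).
Proof. exact/state_pos/positive_square. Qed.

Lemma state_compress y : f (star y * y) != 0 ->
  state (fun x => f (star y * x * y) / f (star y * y)).
Proof.
move=> y0; split=> [c x z _ _||x x0].
- by rewrite mulrDr -scalerAr mulrDl -scalerAl state_lin mulrDl mulrA.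
- by rewrite mulr1 divff.
- by rewrite divr_ge0// ?state_square// state_pos//; exact: positive_compress.
Qed.

Lemma state_bound_sa :
  (forall x, star x = x -> `|f x| <= 2%:R * cnorm x) ->
  forall x, `|f x| <= 4%:R * cnorm x.
Proof.
move=> bound_sa x.
have dec : x = 2%:R^-1 *: ((x + star x) - 'i *: ('i *: (x - star x))).
  rewrite scalerA -expr2 sqrCi scaleN1r opprK addrACA subrr addr0.
  by rewrite -mulr2n -scaler_nat scalerA mulVf ?scale1r// pnatr_eq0.
have sa1 : star (x + star x) = x + star x by rewrite starD starK addrC.
have sa2 : star ('i *: (x - star x)) = 'i *: (x - star x).
  by rewrite starZ conjCi starD starN starK scaleNr -scalerN opprB.
have xx y : star y = star x \/ star y = - star x ->
    cnorm (x + star y) <= 2%:R * cnorm x.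
  move=> h; apply: le_trans (cnormD _ _) _; rewrite mulr_natl mulr2n lerD2l.
  by case: h => ->; rewrite ?cnormN cnorm_star_eq.
rewrite {1}dec stateZ stateB stateZ normrM ger0_norm ?invr_ge0//.
rewrite mulrC ler_pdivrMr//.
apply: le_trans (ler_normB _ _) _; rewrite normrM normCi mul1r.
have -> : 4%:R * cnorm x * 2%:R =
    2%:R * (2%:R * cnorm x) + 2%:R * (2%:R * cnorm x).
  by ring.
apply: lerD;
  [apply: le_trans (bound_sa _ sa1) _|apply: le_trans (bound_sa _ sa2) _].
  by rewrite ler_pM2l//; apply: xx; left.
rewrite cnormZ normCi mul1r ler_pM2l//.
by rewrite -starN; apply: xx; right; rewrite starN.
Qed.

End StateBasics.

Section StateBound.
Context {R : realType} {U : preCstarType R[i]}.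
Implicit Types x t : U.

Lemma complex_expr_lt (r e : R[i]) : 0 <= r < 1 -> 0 < e ->
  exists n, r ^+ n < e.
Proof.
move=> /andP[r0 r1] e0.
have [[r' rE] [e' eE]] : (exists r', r = r'%:C%C) /\ (exists e', e = e'%:C%C).
  split; [exists (complex.Re r)|exists (complex.Re e)]; apply/esym/RRe_real.
    exact: ger0_real.
  exact: gtr0_real.
move: r0 r1 e0; rewrite {}rE {}eE !ltcR !lecR => r0 r1 e0.
have := @cvg_expr _ r'; rewrite ger0_norm// => /(_ r1) /cvgrPdist_lt/(_ e' e0).
move=> [N _ /(_ N (leqnn N))] /=; rewrite sub0r normrN.
rewrite ger0_norm ?exprn_ge0// => h.
by exists N; rewrite -rmorphXn ltcR.
Qed.

(** The square root of [1 - t] need not exist without completeness, but its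
    approximations [1 - sqrt_iter t n] have squares tending to [1 - t]: the error
    is twice the increment of the iteration. *)
Lemma positive_one_sub t : star t = t -> cnorm t < 1 -> positive_in setT (1 - t).
Proof.
move=> ts t1; split=> // e e0.
have [|n ne] := @complex_expr_lt (cnorm t) (e / 2%:R) _ (divr_gt0 e0 (ltr0n _ 2)).
  by rewrite cnorm_ge0.
set y := sqrt_iter t n.
exists (star (1 - y) * (1 - y)); first by exists (1 - y).
have -> : 1 - t - star (1 - y) * (1 - y) = - (2%:R *: (sqrt_iter t n.+1 - y)).
  rewrite starD star1 starN star_sqrt_iter// scalerBr /= -/y scalerA divff ?pnatr_eq0//.
  rewrite scale1r mulrBl mul1r mulrBr mulr1 scaler_nat mulr2n -/y.
  rewrite !opprB (AC (2*(2*2)) ((1*6)*((3*5)*(2*4))))/= subrr add0r.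
  by rewrite opprD.
rewrite cnormN cnormZ normr_nat mulrC -ltr_pdivlMr//.
apply: le_lt_trans ne; apply: le_trans (cnorm_sqrt_iterS n (ltW t1)) _.
by rewrite exprSr ler_piMr ?exprn_ge0 ?cnorm_ge0 ?ltW.
Qed.

(** For self-adjoint [x] both [1 - x / M] and [1 + x / M] are positive once [M]
    exceeds the norm of [x]. The choice of [M] as twice the norm, and the
    splitting of [x] into self-adjoint parts, make the constant 4 instead of the
    optimal 1. *)
Lemma state_bound (f : U -> R[i]) : state f ->
  forall x, `|f x| <= 4%:R * cnorm x.
Proof.
move=> fs.
apply: state_bound_sa => // x xs.
have [x0|x0] := eqVneq (cnorm x) 0.
  by rewrite (cnorm_eq0 _ x0) (state0 fs) normr0 mulr_ge0 ?cnorm_ge0.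
have M0 : 0 < 2%:R * cnorm x by rewrite mulr_gt0// lt0r x0 cnorm_ge0.
set M := 2%:R * cnorm x in M0 *.
have Mc : (M^-1)^* = M^-1 by rewrite conj_Creal// ger0_real// invr_ge0 ltW.
have lt1 : cnorm (M^-1 *: x) < 1.
  rewrite cnormZ ger0_norm ?invr_ge0 ?(ltW M0)// mulrC ltr_pdivrMr// mul1r.
  by rewrite /M mulr_natl mulr2n ltrDl lt0r x0 cnorm_ge0.
have sa : star (M^-1 *: x) = M^-1 *: x by rewrite starZ xs Mc.
have h1 := state_pos fs (positive_one_sub sa lt1).
have h2 : 0 <= f (1 + M^-1 *: x).
  rewrite -[_ *: x]opprK; apply/(state_pos fs)/positive_one_sub.
    by rewrite starN sa.
  by rewrite cnormN.
rewrite (stateB fs) (state1 fs) subr_ge0 in h1.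
rewrite (stateD fs) (state1 fs) addrC -lerBlDr sub0r in h2.
have : `|f (M^-1 *: x)| <= 1.
  have fr : f (M^-1 *: x) \is Num.real by rewrite (ler_real h1) rpred1.
  by rewrite real_ler_norml// h1 h2.
rewrite (stateZ fs) normrM ger0_norm ?invr_ge0 ?(ltW M0)// mulrC.
by rewrite ler_pdivrMr// mul1r.
Qed.

End StateBound.

(** * Bounded families in a pre-C*-algebra *)

(** The base point [i0] keeps the index set nonempty: the unit is nonzero and the
    norms have a supremum. *)
Record bounded_family (R : realType) (U : preCstarType R[i]) (I : Type)
    (i0 : I) := BoundedFamily {
  family_fun :> I -> U ;
  family_bounded : exists M : R[i], forall i, cnorm (family_fun i) <= M
}.

Section BoundedFamilies.
Context {R : realType} {U : preCstarType R[i]} {I : Type} {i0 : I}.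
Local Notation family := (bounded_family U i0).
Implicit Types f g : family.

Lemma family_ext f g : (forall i, f i = g i) -> f = g.
Proof.
case: f g => [f fb] [g gb] /= /funext fg; move: fb gb; rewrite {}fg => fb gb.
by congr BoundedFamily; exact: Prop_irrelevance.
Qed.

Lemma cst_bounded (x : U) : exists M : R[i], forall i : I, cnorm x <= M.
Proof. by exists (cnorm x). Qed.

Definition family_cst x : family := BoundedFamily i0 (cst_bounded x).

Lemma add_bounded f g : exists M : R[i], forall i, cnorm (f i + g i) <= M.
Proof.
have [[M fM] [N gN]] := (family_bounded f, family_bounded g).
by exists (M + N) => i; apply: le_trans (cnormD _ _) (lerD _ _).
Qed.

Lemma opp_bounded f : exists M : R[i], forall i, cnorm (- f i) <= M.
Proof. by have [M fM] := family_bounded f; exists M => i; rewrite cnormN. Qed.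

Lemma mul_bounded f g : exists M : R[i], forall i, cnorm (f i * g i) <= M.
Proof.
have [[M fM] [N gN]] := (family_bounded f, family_bounded g).
by exists (M * N) => i; apply: le_trans (cnormM _ _) (ler_pM _ _ _ _);
  rewrite ?cnorm_ge0.
Qed.

Lemma scale_bounded (c : R[i]) f : exists M : R[i], forall i, cnorm (c *: f i) <= M.
Proof.
have [M fM] := family_bounded f.
by exists (`|c| * M) => i; rewrite cnormZ ler_wpM2l.
Qed.

Lemma star_bounded f : exists M : R[i], forall i, cnorm (star (f i)) <= M.
Proof. by have [M fM] := family_bounded f; exists M => i; rewrite cnorm_star_eq. Qed.

Definition family_add f g : family := BoundedFamily i0 (add_bounded f g).
Definition family_opp f : family := BoundedFamily i0 (opp_bounded f).
Definition family_mul f g : family := BoundedFamily i0 (mul_bounded f g).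
Definition family_scale c f : family := BoundedFamily i0 (scale_bounded c f).
Definition family_star f : family := BoundedFamily i0 (star_bounded f).

HB.instance Definition _ := gen_eqMixin family.
HB.instance Definition _ := gen_choiceMixin family.

Lemma family_addA : associative family_add.
Proof. by move=> f g h; apply: family_ext => i /=; rewrite addrA. Qed.
Lemma family_addC : commutative family_add.
Proof. by move=> f g; apply: family_ext => i /=; rewrite addrC. Qed.
Lemma family_add0 : left_id (family_cst 0) family_add.
Proof. by move=> f; apply: family_ext => i /=; rewrite add0r. Qed.
Lemma family_addN : left_inverse (family_cst 0) family_opp family_add.
Proof. by move=> f; apply: family_ext => i /=; rewrite addNr. Qed.

HB.instance Definition _ := GRing.isZmodule.Build family
  family_addA family_addC family_add0 family_addN.

Lemma family_mulA : associative family_mul.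
Proof. by move=> f g h; apply: family_ext => i /=; rewrite mulrA. Qed.
Lemma family_mul1 : left_id (family_cst 1) family_mul.
Proof. by move=> f; apply: family_ext => i /=; rewrite mul1r. Qed.
Lemma family_1mul : right_id (family_cst 1) family_mul.
Proof. by move=> f; apply: family_ext => i /=; rewrite mulr1. Qed.
Lemma family_mulDl : left_distributive family_mul +%R.
Proof. by move=> f g h; apply: family_ext => i /=; rewrite mulrDl. Qed.
Lemma family_mulDr : right_distributive family_mul +%R.
Proof. by move=> f g h; apply: family_ext => i /=; rewrite mulrDr. Qed.
Lemma family_oner_neq0 : family_cst 1 != 0.
Proof.
by apply/eqP => /(congr1 (fun f : family => f i0))/eqP; rewrite oner_eq0.
Qed.

HB.instance Definition _ := GRing.Zmodule_isNzRing.Build family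
  family_mulA family_mul1 family_1mul family_mulDl family_mulDr
  family_oner_neq0.

Lemma family_scaleA a b f :
  family_scale a (family_scale b f) = family_scale (a * b) f.
Proof. by apply: family_ext => i /=; rewrite scalerA. Qed.
Lemma family_scale1 : left_id 1 family_scale.
Proof. by move=> f; apply: family_ext => i /=; rewrite scale1r. Qed.
Lemma family_scaleDr : right_distributive family_scale +%R.
Proof. by move=> a f g; apply: family_ext => i /=; rewrite scalerDr. Qed.
Lemma family_scaleDl f : {morph family_scale^~ f : a b / a + b}.
Proof. by move=> a b; apply: family_ext => i /=; rewrite scalerDl. Qed.

HB.instance Definition _ := GRing.Zmodule_isLmodule.Build R[i] family
  family_scaleA family_scale1 family_scaleDr family_scaleDl.

Lemma family_scaleAl (a : R[i]) f g : a *: (f * g) = a *: f * g.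
Proof. by apply: family_ext => i /=; rewrite scalerAl. Qed.
Lemma family_scaleAr (a : R[i]) f g : a *: (f * g) = f * (a *: g).
Proof. by apply: family_ext => i /=; rewrite scalerAr. Qed.

HB.instance Definition _ := GRing.Lmodule_isLalgebra.Build R[i] family
  family_scaleAl.
HB.instance Definition _ := GRing.Lalgebra_isAlgebra.Build R[i] family
  family_scaleAr.

Definition family_norm f : R[i] :=
  (sup (range (fun i => complex.Re (cnorm (f i)))))%:C%C.

Lemma Re_cnorm (x : U) : (complex.Re (cnorm x))%:C%C = cnorm x.
Proof. exact/RRe_real/ger0_real/cnorm_ge0. Qed.

Lemma le_Re (x y : R[i]) : x <= y -> complex.Re x <= complex.Re y.
Proof. by rewrite lecE => /andP[]. Qed.

Lemma family_norm_ge f i : cnorm (f i) <= family_norm f.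
Proof.
rewrite -Re_cnorm lecR; apply: sup_upper_bound; last by exists i.
split; first by exists (complex.Re (cnorm (f i0))), i0.
have [M fM] := family_bounded f; exists (complex.Re M) => _ [k _ <-].
exact: le_Re.
Qed.

Lemma family_norm_le f M : (forall i, cnorm (f i) <= M) -> family_norm f <= M.
Proof.
move=> fM; have M0 : 0 <= M by exact: le_trans (cnorm_ge0 _) (fM i0).
rewrite -[M]RRe_real ?ger0_real// lecR; apply: ge_sup.
  by exists (complex.Re (cnorm (f i0))), i0.
by move=> _ [k _ <-]; exact: le_Re.
Qed.

Lemma family_norm_ge0 f : 0 <= family_norm f.
Proof. exact: le_trans (cnorm_ge0 _) (family_norm_ge f i0). Qed.

Lemma family_starK : involutive family_star.
Proof. by move=> f; apply: family_ext => i /=; rewrite starK. Qed.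
Lemma family_starD : {morph family_star : f g / f + g}.
Proof. by move=> f g; apply: family_ext => i /=; rewrite starD. Qed.
Lemma family_starZ (c : R[i]) f : family_star (c *: f) = c^* *: family_star f.
Proof. by apply: family_ext => i /=; rewrite starZ. Qed.
Lemma family_starM f g : family_star (f * g) = family_star g * family_star f.
Proof. by apply: family_ext => i /=; rewrite starM. Qed.

Lemma family_norm_eq0 f : family_norm f = 0 -> f = 0.
Proof.
move=> f0; apply: family_ext => i /=; apply/cnorm_eq0/le_anti.
by rewrite cnorm_ge0 -f0 family_norm_ge.
Qed.

Lemma family_normD f g : family_norm (f + g) <= family_norm f + family_norm g.
Proof.
apply: family_norm_le => i; apply: le_trans (cnormD _ _) _.
by apply: lerD; exact: family_norm_ge.
Qed.

Lemma family_normZ (c : R[i]) f : family_norm (c *: f) = `|c| * family_norm f.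
Proof.
apply: le_anti; apply/andP; split.
  apply: family_norm_le => i; rewrite cnormZ ler_wpM2l//.
  exact: family_norm_ge.
have [->|c0] := eqVneq c 0; first by rewrite normr0 mul0r family_norm_ge0.
have cp : 0 < `|c| by rewrite normr_gt0.
rewrite mulrC -ler_pdivlMr//; apply: family_norm_le => i.
by rewrite ler_pdivlMr// mulrC -cnormZ (family_norm_ge (c *: f)).
Qed.

Lemma family_normM f g : family_norm (f * g) <= family_norm f * family_norm g.
Proof.
apply: family_norm_le => i; apply: le_trans (cnormM _ _) _.
by apply: ler_pM; rewrite ?cnorm_ge0 ?family_norm_ge.
Qed.

Lemma family_norm_star f : family_norm (family_star f * f) = family_norm f ^+ 2.
Proof.
apply: le_anti; apply/andP; split.
  apply: family_norm_le => i /=; rewrite cnorm_star.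
  by rewrite lerXn2r ?nnegrE ?cnorm_ge0 ?family_norm_ge0 ?family_norm_ge.
rewrite -[leRHS]sqrtCK lerXn2r ?nnegrE ?family_norm_ge0//.
  by rewrite sqrtC_ge0 family_norm_ge0.
apply: family_norm_le => i.
rewrite -[leLHS]sqrCK ?cnorm_ge0// ler_sqrtC ?qualifE/= ?family_norm_ge0//.
  by rewrite -cnorm_star (family_norm_ge (family_star f * f)).
by rewrite exprn_ge0 ?cnorm_ge0.
Qed.

HB.instance Definition _ := isPreCstar.Build R[i] family
  family_starK family_starD family_starZ family_starM family_norm_eq0
  family_normD family_normZ family_normM family_norm_star.

Lemma family_cst_additive : zmod_morphism family_cst.
Proof. by move=> x y; apply: family_ext. Qed.
HB.instance Definition _ :=
  GRing.isZmodMorphism.Build U family family_cst family_cst_additive.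

Lemma family_cst_multiplicative : monoid_morphism family_cst.
Proof. by split=> [|x y]; apply: family_ext. Qed.
HB.instance Definition _ :=
  GRing.isMonoidMorphism.Build U family family_cst family_cst_multiplicative.

Lemma family_cst_scalable : scalable family_cst.
Proof. by move=> c x; apply: family_ext. Qed.
HB.instance Definition _ :=
  GRing.isScalable.Build R[i] U family *:%R family_cst family_cst_scalable.

Lemma positive_family f i : positive_in setT f -> positive_in setT (f i).
Proof.
move=> [_ fp]; split=> // e e0; have [_ [g _ <-] fg] := fp e e0.
exists (star (g i) * g i); first by exists (g i).
exact: le_lt_trans (family_norm_ge (f - star g * g) i) fg.
Qed.

End BoundedFamilies.

(** * The conditional expectation given by a family of states *)

Section StateExpectation.
Context {R : realType} {U : preCstarType R[i]} {I : Type} {i0 : I}.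
Variable w : I -> U -> R[i].
Hypothesis wstate : forall i, state (w i).
Local Notation family := (bounded_family U i0).
Implicit Types f g : family.

Lemma state_family_bounded f :
  exists M : R[i], forall i, cnorm (w i (f i) *: (1 : U)) <= M.
Proof.
have [M fM] := family_bounded f; exists (4%:R * M) => i.
rewrite cnormZ cnorm1 mulr1; apply: le_trans (state_bound (wstate i) _) _.
by rewrite ler_pM2l.
Qed.

Definition state_expectation f : family :=
  BoundedFamily i0 (state_family_bounded f).

Lemma state_expectation_linear : linear state_expectation.
Proof.
move=> c f g; apply: family_ext => i /=.
by rewrite (state_lin (wstate i)) scalerDl scalerA.
Qed.
HB.instance Definition _ :=
  GRing.isLinear.Build R[i] family family *:%R state_expectation
    state_expectation_linear.

(** States fix scalars, so that the range consists of all scalar families. *)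
Lemma scalar_family f (c : I -> R[i]) :
  (forall i, f i = c i *: 1) -> range state_expectation f.
Proof.
move=> fc; exists f => //; apply: family_ext => i /=.
by rewrite fc (stateZ (wstate i)) (state1 (wstate i)) mulr1.
Qed.

(** Positivity into the range holds because nonnegative scalar families have
    square roots that are again scalar families. *)
Lemma conditional_expectation_states :
  conditional_expectation (range state_expectation) state_expectation.
Proof.
split; [split| | | |].
- by apply: (@scalar_family _ (fun=> 1)) => i; rewrite scale1r.
- move=> c _ _ [f _ <-] [g _ <-].
  apply: (@scalar_family _ (fun i => c * w i (f i) + w i (g i))) => i /=.
  by rewrite scalerDl scalerA.
- move=> _ _ [f _ <-] [g _ <-].
  apply: (@scalar_family _ (fun i => w i (f i) * w i (g i))) => i /=.
  by rewrite -scalerAl mul1r scalerA.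
- move=> _ [f _ <-].
  apply: (@scalar_family _ (fun i => (w i (f i))^*)) => i /=.
  by rewrite starZ star1.
- by [].
- by apply: family_ext => i /=; rewrite (state1 (wstate i)) scale1r.
- move=> f f0; split=> // e e0.
  have wf i : 0 <= w i (f i) by exact/(state_pos (wstate i))/positive_family.
  have rb : exists M : R[i], forall i, cnorm (sqrtC (w i (f i)) *: (1 : U)) <= M.
    have [M wM] := state_family_bounded f; exists (sqrtC M) => i.
    move: (wM i); rewrite !cnormZ cnorm1 !mulr1 !ger0_norm ?sqrtC_ge0// => wi.
    by rewrite ler_sqrtC ?qualifE/=//; exact: le_trans (wf i) wi.
  pose r : family := BoundedFamily i0 rb.
  exists (star r * r).
    by exists r => //; apply: (@scalar_family _ (fun i => sqrtC (w i (f i)))).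
  suff -> : star r * r = state_expectation f by rewrite subrr cnorm0.
  apply: family_ext => i /=; rewrite starZ star1 -scalerAl mul1r scalerA.
  by rewrite conj_Creal ?ger0_real ?sqrtC_ge0// -expr2 sqrtCK.
- move=> _ f _ [g _ <-] [h _ <-]; apply: family_ext => i /=.
  rewrite -scalerAl mul1r -scalerAr mulr1 -scalerAl mul1r -scalerAr mulr1.
  by rewrite !(stateZ (wstate i)) !scalerA; congr (_ *: _); ring.
Qed.

Lemma evaluation_state (B : set family) i : state_on B (fun f => w i (f i)).
Proof.
split=> [c f g _ _||f [_ f0]] /=.
- exact: (state_lin (wstate i)).
- exact: (state1 (wstate i)).
- apply/(state_pos (wstate i))/positive_family; split=> // e /f0[_ [g _ <-] fg].
  by exists (star g * g) => //; exists g.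
Qed.

End StateExpectation.

(** * Noncrossing partitions and vanishing moments *)

Definition transpose (a b k : nat) : nat :=
  if k == a then b else if k == b then a else k.

Lemma transposeK a b : involutive (transpose a b).
Proof.
move=> k; rewrite /transpose; case: (eqVneq k a) => [->|ka].
  by case: (eqVneq b a) => [->//|_]; rewrite eqxx.
by case: (eqVneq k b) => [->|kb]; rewrite ?eqxx// (negPf ka) (negPf kb).
Qed.

Lemma transpose_bij a b : bijective (transpose a b).
Proof. exact/inv_bij/transposeK. Qed.

Lemma transposeL a b : transpose a b a = b.
Proof. by rewrite /transpose eqxx. Qed.

Lemma transpose_id a b k : k != a -> k != b -> transpose a b k = k.
Proof. by rewrite /transpose => /negPf-> /negPf->. Qed.

(** A finite partial injection extends to a permutation: after extending it on
    all points but the last, a transposition corrects the last value and moves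
    none of the previous ones. *)
Lemma bijection_extend n (f g : 'I_n -> nat) :
  (forall i j, f i = f j <-> g i = g j) ->
  exists2 s, bijective s & forall i, s (f i) = g i.
Proof.
elim: n f g => [|n IH] f g fg; first by exists id => [|[]//]; exists id.
have [s sb sf] := IH (f \o lift ord_max) (g \o lift ord_max) (fun i j => fg _ _).
exists (transpose (s (f ord_max)) (g ord_max) \o s) => [|i /=].
  by apply: bij_comp => //; exact: transpose_bij.
case: (unliftP ord_max i) => [k|] ->; last by rewrite transposeL.
rewrite -[s (f (lift _ _))]/(s ((f \o lift ord_max) k)) sf /=.
have [e|/eqP ne] := eqVneq (g (lift ord_max k)) (g ord_max).
  have /fg/(congr1 s) := e; rewrite [LHS](sf k) /= e => <-.
  by rewrite transposeL.
apply: transpose_id; last exact/eqP.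
apply/eqP => e; apply/ne/fg; apply: (bij_inj sb).
by rewrite -e; exact: sf.
Qed.

Section Blocks.
Context {n : nat}.
Implicit Types p q : set_partition n.

Lemma set_partition_cover p i : i \in finset.cover p.
Proof. by rewrite (finset.cover_partition (valP p)) inE. Qed.

Lemma block_mem p i : block p i \in blocks p.
Proof. exact/finset.pblock_mem/set_partition_cover. Qed.

Lemma mem_block p i : i \in block p i.
Proof. by rewrite finset.mem_pblock set_partition_cover. Qed.

Lemma block_eq p (B : {set 'I_n}) i : B \in blocks p -> i \in B -> block p i = B.
Proof.
have /and3P[_ tp _] := valP p; exact: (finset.def_pblock tp).
Qed.

Lemma block_finer p q i j : (p <= q)%O ->
  block p i = block p j -> block q i = block q j.
Proof.
move=> /forall_inP/(_ _ (block_mem p i))/exists_inP[D Dq /fintype.subsetP BD] ij.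
rewrite (block_eq Dq (BD _ (mem_block p i))).
by rewrite (block_eq Dq (BD _ _))// ij mem_block.
Qed.

Lemma block_number_eq p i j :
  block_number p i = block_number p j <-> block p i = block p j.
Proof.
rewrite /block_number; split=> [|->//].
by move/(@index_inj _ (block p i)); apply; rewrite fintype.mem_enum block_mem.
Qed.

Definition kernel_partition (h : 'I_n -> nat) : set_partition n :=
  SetPartition (finset.preim_partitionP h [set: 'I_n]%SET).

Lemma block_kernel h i j :
  block (kernel_partition h) i = block (kernel_partition h) j <-> h i = h j.
Proof.
have eqv : {in [set: 'I_n]%SET & &, equivalence_rel (fun x y => h x == h y)}.
  by move=> x y z _ _ _; split=> // /eqP ->.
have mem k : (k \in block (kernel_partition h) i) = (h i == h k).
  by apply: finset.pblock_equivalence_partition; rewrite ?inE.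
split=> [e|/eqP ij].
  by apply/eqP; rewrite -mem e mem_block.
by apply/esym/block_eq; rewrite ?block_mem// mem.
Qed.

(** With [r] the relation of lying in the same block, the positions in the
    interval from [a] to [b.-1] form a union of blocks, none of which contains
    two neighbouring positions. *)
Definition separated (a b : nat) (r : 'I_n -> 'I_n -> Prop) : Prop :=
  forall i j : 'I_n, (a <= i < b)%N ->
    (j == i.+1 :> nat) || ~~ (a <= j < b)%N -> ~ r i j.

(** If every position of the interval had a partner in its block, a pair of
    partners [i < k] at minimal distance would enclose the position [i.+1], and
    the block of [i.+1] would cross the block of [i]. *)
Lemma noncrossing_singleton (a b : nat) p : (a < b <= n)%N -> noncrossing p ->
  separated a b (fun i j => block p i = block p j) ->
  exists2 i : 'I_n, (a <= i < b)%N & forall k, k != i -> block p k <> block p i.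
Proof.
move=> /andP[ab bn] nc sep; apply: contrapT => no.
have partner (i : 'I_n) : (a <= i < b)%N ->
    exists2 k : 'I_n, (a <= k < b)%N & k != i /\ block p k = block p i.
  move=> iab; apply: contrapT => noi; apply: no; exists i => // k ki e.
  apply: noi; exists k => //; have [//|kab] := boolP (a <= k < b)%N.
  by case: (sep i k iab _ (esym e)); rewrite kab orbT.
have nopair d (i k : 'I_n) : (a <= i)%N -> (k < b)%N -> (i < k)%N ->
    (k - i)%N = d -> block p i = block p k -> False.
  elim/ltn_ind: d i k => d IH i k ai kb ik kid eik.
  have jn : (i.+1 < n)%N by exact: leq_ltn_trans ik (ltn_ord k).
  pose j := Ordinal jn.
  have ij : block p i <> block p j.
    by apply: sep; rewrite /= ?eqxx// ai /=; lia.
  have jk : (j < k)%N.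
    rewrite ltn_neqAle ik andbT; apply/eqP => /val_inj jk.
    by apply: ij; rewrite eik jk.
  have [|l lab [lj elj]] := partner j; first by rewrite /=; lia.
  case: (ltngtP l j) => [lt_lj|lt_jl|/val_inj e]; last by rewrite e eqxx in lj.
    have li : (l < i)%N.
      rewrite ltn_neqAle -ltnS lt_lj andbT; apply/eqP => /val_inj li.
      by apply: ij; rewrite -li.
    apply: nc; exists l, i, j, k; split=> //; first by rewrite li jk /= ltnSn.
    by move=> e; apply: ij; rewrite -e.
  case: (ltngtP l k) => [lt_lk|lt_kl|/val_inj e].
  - by apply: (IH (l - j)%N _ j l) => //=; rewrite /j/=; lia.
  - apply: nc; exists i, j, k, l; split=> //.
    by rewrite /= lt_kl jk /=; lia.
  - by apply: ij; rewrite eik -e.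
have an : (a < n)%N by exact: leq_trans ab bn.
have [|k kab [ka ek]] := partner (Ordinal an); first by rewrite /= leqnn.
have ak : (a < k)%N.
  rewrite ltn_neqAle; case/andP: kab => -> _; rewrite andbT eq_sym.
  by apply: contraNN ka => /eqP e; apply/eqP/val_inj.
apply: (nopair _ (Ordinal an) k _ _ ak erefl (esym ek)) => //.
by case/andP: kab.
Qed.

End Blocks.

Section VanishingMoments.
Context {C : numClosedFieldType} {A : preCstarType C} {phi : A -> C}.
Variable E : exchangeability_system phi.

(** By exchangeability this number is the limit, as [N] grows, of the squared
    norms of the averages of [N] copies of [X] in the GNS space. *)
Definition null (X : A) : Prop :=
  exch_state (star (exch_emb E 0%N X) * exch_emb E 1%N X) = 0.

(** The case of a single copy, moved to the [k]-th place by the transposition of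
    0 and [k]. *)
Lemma weak_singleton n (X : 'I_n -> A) (h : 'I_n -> nat) j :
  extended_weak_singleton E -> null (X j) -> (forall k, k != j -> h k != h j) ->
  exch_state (\prod_(i < n) exch_emb E (h i) (X i)) = 0.
Proof.
move=> ews Xj hj.
have sE k x : exch_act E (transpose 0 k) (exch_emb E 0%N x) = exch_emb E k x.
  by rewrite (exch_act_emb E (transpose_bij 0 k)) transposeL.
have := @ews [set 0%N] (fun k => [set k]) (transpose 0) (finite_set1 _).
have triv : trivIset setT (fun k : nat => [set k]).
  by move=> i k _ _ [_ [-> ->]].
have bij k : set_bij [set 0%N] [set k] (transpose 0 k).
  split=> [_ ->|x y|_ ->] /=; first by rewrite transposeL.
    by rewrite !inE => -> ->.
  by exists 0%N; rewrite ?transposeL.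
have sub k : exch_subalg [set 0%N] (exch_emb E 0%N (X k)).
  by move=> S [_ h0]; apply: h0; exists 0%N => //; exists (X k).
move=> /(_ triv (transpose_bij 0) bij n _ h sub j hj).
under eq_bigr do rewrite sE.
by apply; rewrite !sE.
Qed.

(** For a crossing partition the vanishing of its cumulant expresses the moment
    through moments of strictly finer partitions, which are again separated; a
    noncrossing separated partition has a singleton at a null position. *)
Lemma separated_partition_moment n (X : 'I_n -> A) (a b : nat)
    (p : set_partition n) :
  noncrossing_system E -> extended_weak_singleton E -> (a < b <= n)%N ->
  (forall i : 'I_n, (a <= i < b)%N -> null (X i)) ->
  separated a b (fun i j => block p i = block p j) ->
  exch_phi E p X = 0.
Proof.
move=> ncE ews ab nX.
have [m] := ubnP #|[pred q : set_partition n | (q < p)%O]|.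
elim: m p => [//|m IH] p pm sep.
have [nc|cr] := pselect (noncrossing p).
  have [i iab single] := noncrossing_singleton ab nc sep.
  apply: (@weak_singleton _ X (block_number p) i) => //; first exact: nX.
  by move=> k ki; apply/eqP => /block_number_eq; exact: single.
have := ncE n X p cr; rewrite /exch_cumulant (bigD1 p)//= moebius_refl mulr1.
rewrite big1 ?addr0// => q /andP[qp qNp]; rewrite IH ?mul0r//.
  have {qp qNp}qp : (q < p)%O by rewrite lt_neqAle qNp.
  rewrite -ltnS; apply: leq_trans _ pm; rewrite ltnS; apply: proper_card.
  apply/properP; split.
    by apply/fintype.subsetP => r; rewrite !inE => /lt_trans; apply.
  by exists q; rewrite !inE// ltxx.
by move=> i j iab ij /(block_finer qp); exact: sep.
Qed.

(** By exchangeability a word depends only on the kernel of its colouring. *)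
Lemma separated_moment n (X : 'I_n -> A) (h : 'I_n -> nat) (a b : nat) :
  noncrossing_system E -> extended_weak_singleton E -> (a < b <= n)%N ->
  (forall i : 'I_n, (a <= i < b)%N -> null (X i)) ->
  separated a b (fun i j => h i = h j) ->
  exch_state (\prod_(i < n) exch_emb E (h i) (X i)) = 0.
Proof.
move=> ncE ews ab nX sep; pose p := kernel_partition h.
have [|s sb sh] := @bijection_extend _ h (block_number p).
  by move=> i j; rewrite block_number_eq block_kernel.
rewrite (exch_exchangeable _ _ _ sb); under eq_bigr do rewrite sh.
apply: (separated_partition_moment ncE ews ab nX) => i j iab ij.
by move=> /block_kernel; exact: sep.
Qed.

End VanishingMoments.

(** * Limits of states *)

Definition tends_to (C : numClosedFieldType) (u : nat -> C) (c : C) : Prop :=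
  forall e : C, 0 < e -> exists N, forall m, (N <= m)%N -> `|u m - c| < e.

Section TendsTo.
Context {C : numClosedFieldType}.
Implicit Types (u v : nat -> C) (c d : C).

Lemma norm_small_eq0 c : (forall e : C, 0 < e -> `|c| < e) -> c = 0.
Proof.
move=> h; apply/eqP/contraT => c0.
by have := h `|c|; rewrite normr_gt0 ltxx => /(_ c0).
Qed.

Lemma tends_to_unique u c d : tends_to u c -> tends_to u d -> c = d.
Proof.
move=> uc ud; apply/subr0_eq/norm_small_eq0 => e e0.
have e2 : 0 < e / 2%:R by rewrite divr_gt0.
have [[M Mu] [N Nu]] := (uc _ e2, ud _ e2).
have := Mu _ (leq_maxl M N); have := Nu _ (leq_maxr M N).
move: (u _) => z zd zc; rewrite -(subrK z c) -addrA.
apply: le_lt_trans (ler_normD _ _) _; rewrite distrC.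
by rewrite [e in _ < e]splitr ltrD.
Qed.

Lemma tends_to_eventually u c N :
  (forall m, (N <= m)%N -> u m = c) -> tends_to u c.
Proof. by move=> uc e e0; exists N => m /uc ->; rewrite subrr normr0. Qed.

Lemma tends_to_lin a u v c d : tends_to u c -> tends_to v d ->
  tends_to (fun m => a * u m + v m) (a * c + d).
Proof.
move=> uc vd e e0.
have M0 : 0 < `|a| + 1 by rewrite ltr_wpDl.
have [|M Mu] := uc (e / 2%:R / (`|a| + 1)); first by rewrite !divr_gt0.
have [|N Nv] := vd (e / 2%:R); first by rewrite divr_gt0.
exists (maxn M N) => m; rewrite geq_max => /andP[/Mu um /Nv vm].
have -> : a * u m + v m - (a * c + d) = a * (u m - c) + (v m - d) by ring.
apply: le_lt_trans (ler_normD _ _) _; rewrite [e in _ < e]splitr.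
apply: ler_ltD => //; rewrite normrM; move: um; rewrite ltr_pdivlMr// => um.
by apply: le_trans (ltW um); rewrite mulrC ler_wpM2l// lerDl.
Qed.

Lemma tends_to_ge0 u c : (forall m, 0 <= u m) -> tends_to u c -> 0 <= c.
Proof.
move=> u0 uc; suff -> : c = `|c| by [].
apply/esym/subr0_eq/norm_small_eq0 => e e0.
have [|N /(_ _ (leqnn N)) uN] := uc (e / 2%:R); first by rewrite divr_gt0.
have -> : `|c| - c = (`|c| - `|u N|) + (u N - c).
  by rewrite [`|u N|]ger0_norm// addrA subrK.
apply: le_lt_trans (ler_normD _ _) _; rewrite [e in _ < e]splitr.
by apply: ler_ltD => //; apply: le_trans (ler_dist_dist _ _) _; rewrite distrC ltW.
Qed.

End TendsTo.

Section StateLimit.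
Import numFieldNormedType.Exports.
Context {R : realType}.

Lemma real_cauchy (u : nat -> R) :
  (forall e, 0 < e -> exists N, forall m, (N <= m)%N -> `|u N - u m| < e) ->
  exists c, forall e, 0 < e -> exists N, forall m, (N <= m)%N -> `|u m - c| < e.
Proof.
move=> uc; have /cauchy_cvgP/cvg_ex[/= c uc'] : cauchy (u @ \oo).
  by apply: cauchy_exP => e /uc[N uN]; exists (u N); exists N.
exists c => e e0; have /cvgrPdist_lt/(_ e e0)[N _ uN] := uc'.
by exists N => m Nm; rewrite distrC; exact: uN.
Qed.

Lemma norm_complexR (x : R) : `|x%:C%C| = `|x|%:C%C.
Proof. by rewrite normc_def /= expr0n/= addr0 sqrtr_sqr. Qed.

Lemma complex_cauchy (u : nat -> R[i]) :
  (forall e : R[i], 0 < e -> exists N, forall m, (N <= m)%N -> `|u N - u m| < e) ->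
  exists c, tends_to u c.
Proof.
move=> uc.
have part (p : {additive R[i] -> R}) : (forall z, `|p z|%:C%C <= `|z|) ->
    exists c, forall e, 0 < e -> exists N, forall m, (N <= m)%N ->
      `|p (u m) - c| < e.
  move=> pn; apply: real_cauchy => e e0.
  have [|N uN] := uc e%:C%C; first by rewrite ltcR.
  exists N => m /uN; rewrite -raddfB -ltcR; exact: le_lt_trans.
have [a ua] := part (@complex.Re R) (@normc_ge_Re R).
have [|b ub] := part (@complex.Im R).
  by case=> x y; rewrite normc_def lecR -sqrtr_sqr ler_wsqrtr// lerDr sqr_ge0.
exists (a +i* b)%C => e e0.
have [e' eE] : exists e', e = e'%:C%C.
  by exists (complex.Re e); exact/esym/RRe_real/gtr0_real.
move: e0; rewrite {}eE ltcR => e0; have e2 : 0 < e' / 2%:R by rewrite divr_gt0.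
have [[M uM] [N uN]] := (ua _ e2, ub _ e2).
exists (maxn M N) => m; rewrite geq_max => /andP[/uM um /uN vm].
have -> : u m - (a +i* b)%C =
    (complex.Re (u m) - a)%:C%C + 'i%C * (complex.Im (u m) - b)%:C%C.
  by case: (u m) => x y; simpc.
apply: le_lt_trans (ler_normD _ _) _; rewrite normrM complexiE normCi mul1r.
by rewrite !norm_complexR -rmorphD ltcR [e']splitr ltrD.
Qed.

(** States are uniformly bounded, so that convergence on a dense subset gives
    convergence everywhere. *)
Lemma state_limit (U : preCstarType R[i]) (f : nat -> U -> R[i]) (D : set U) :
  (forall m, state (f m)) -> norm_closure D = setT ->
  (forall u, D u -> exists N, forall m, (N <= m)%N -> f m u = f N u) ->
  exists2 g, state g &
    forall u N, (forall m, (N <= m)%N -> f m u = f N u) -> g u = f N u.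
Proof.
move=> fs dense ev.
have /choice[g fg] : forall u, exists c, tends_to (f ^~ u) c.
  move=> u; apply: complex_cauchy => e e0.
  have : norm_closure D u by rewrite dense.
  have e8 : 0 < e / 8%:R by rewrite divr_gt0.
  move=> /(_ _ e8)[v /ev[N vN] uv]; exists N => m /vN fv.
  have -> : f N u - f m u = f N (u - v) - f m (u - v).
    by rewrite !stateB// fv; ring.
  have small k : `|f k (u - v)| < e / 2%:R.
    apply: le_lt_trans (state_bound (fs k) _) _; rewrite mulrC.
    by move: uv; rewrite !ltr_pdivlMr// -mulrA -natrM.
  by apply: le_lt_trans (ler_normB _ _) _; rewrite [e in _ < e]splitr ltrD.
exists g => [|u N uN].
- split=> [c x y _ _||x x0].
  + apply: (tends_to_unique (fg _)).
    under [X in tends_to X _]eq_fun do rewrite (state_lin (fs _)).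
    exact: tends_to_lin.
  + apply: (tends_to_unique (fg _)); apply: (@tends_to_eventually _ _ _ 0) => m _.
    exact: state1.
  + by apply: tends_to_ge0 (fg x) => m; exact: state_pos.
- exact/(tends_to_unique (fg u))/(tends_to_eventually uN).
Qed.

End StateLimit.

(** * Exchangeable states seen from a far copy *)

Section Admissible.
Context {C : numClosedFieldType} {A : preCstarType C} {phi : A -> C}.
Variable E : exchangeability_system phi.

(** Freeness of the copies with respect to [w], except that the letters are
    required to be null for the original state rather than centred for [w]. *)
Definition admissible (w : E -> C) : Prop :=
  [/\ state w,
      forall n (X : 'I_n -> A) (h : 'I_n -> nat) s, bijective s ->
        w (\prod_(i < n) exch_emb E (h i) (X i)) =
        w (\prod_(i < n) exch_emb E (s (h i)) (X i))
    & forall n (X : 'I_n -> A) (h : 'I_n -> nat), (0 < n)%N ->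
        (forall i, null E (X i)) ->
        (forall i j : 'I_n, j = i.+1 :> nat -> h i <> h j) ->
        w (\prod_(i < n) exch_emb E (h i) (X i)) = 0].

Lemma exch_state_admissible : noncrossing_system E ->
  extended_weak_singleton E -> admissible (@exch_state _ _ _ E).
Proof.
move=> ncE ews; split; first exact: exch_state_is_state.
  by move=> n X h s sb; exact: exch_exchangeable.
move=> n X h n0 nX alt.
apply: (@separated_moment _ _ _ E _ _ _ 0 n) => //; first by rewrite n0 leqnn.
by move=> i j _; rewrite ltn_ord orbF => /eqP; exact: alt.
Qed.

(** Invariance under the permutations of the remote copies stands for being
    generated by the first [N] copies; it is visibly preserved by the algebraic
    operations. *)
Definition fixed_beyond (N : nat) (u : E) : Prop :=
  forall s, bijective s -> (forall k, (k < N)%N -> s k = k) -> exch_act E s u = u.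

Definition local_elements : set E := [set u | exists N, fixed_beyond N u].

Lemma fixed_beyond_le M N u : (M <= N)%N -> fixed_beyond M u -> fixed_beyond N u.
Proof.
by move=> MN uM s sb sN; apply: uM => // k kM; apply: sN; exact: leq_trans MN.
Qed.

Lemma fixed_beyond_emb k x : fixed_beyond k.+1 (exch_emb E k x).
Proof. by move=> s sb sk; rewrite (exch_act_emb E sb) sk. Qed.

Lemma local_subalgebra : star_subalgebra local_elements.
Proof.
have two u v : local_elements u -> local_elements v ->
    exists N, fixed_beyond N u /\ fixed_beyond N v.
  move=> [M uM] [N vN]; exists (maxn M N).
  by split; [apply: fixed_beyond_le uM|apply: fixed_beyond_le vN];
    rewrite ?leq_maxl ?leq_maxr.
split.
- by exists 0%N => s sb _; rewrite rmorph1.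
- move=> c u v lu lv; have [N [uN vN]] := two _ _ lu lv.
  by exists N => s sb sN; rewrite linearP/= uN// vN.
- move=> u v lu lv; have [N [uN vN]] := two _ _ lu lv.
  by exists N => s sb sN; rewrite rmorphM/= uN// vN.
- by move=> u [N uN]; exists N => s sb sN; rewrite exch_act_star// uN.
Qed.

Lemma local_dense : norm_closure local_elements = setT.
Proof.
rewrite -subTset -(exch_generated E) => u + e e0 => /(_ e e0)[v gv uv].
exists v => //; apply: gv; split; first exact: local_subalgebra.
by move=> _ [k _ [x _ <-]]; exists k.+1; exact: fixed_beyond_emb.
Qed.

Lemma local_word n (X : 'I_n -> A) (h : 'I_n -> nat) :
  local_elements (\prod_(i < n) exch_emb E (h i) (X i)).
Proof.
have [l1 _ lM _] := local_subalgebra.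
by apply: big_ind => // i _; exists (h i).+1; exact: fixed_beyond_emb.
Qed.

Definition far_form (y : A) (m : nat) (u : E) : C :=
  exch_state (star (exch_emb E m y) * u * exch_emb E m y).

Lemma far_form_act y m u s : bijective s ->
  far_form y m u = far_form y (s m) (exch_act E s u).
Proof.
move=> sb; rewrite /far_form -(exch_act_state sb) !rmorphM/=.
by rewrite exch_act_star// exch_act_emb.
Qed.

Lemma far_form1 y m : far_form y m 1 = phi (star y * y).
Proof.
by rewrite /far_form mulr1 -exch_emb_star -rmorphM exch_emb_state.
Qed.

(** The transposition of [m] and [N] fixes [u]. *)
Lemma far_form_eventually y N m u : fixed_beyond N u -> (N <= m)%N ->
  far_form y m u = far_form y N u.
Proof.
move=> uN Nm; rewrite (far_form_act _ _ _ (transpose_bij m N)) transposeL uN//.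
  exact: transpose_bij.
move=> k kN; apply: transpose_id; rewrite neq_ltn ?kN//.
by rewrite (leq_trans kN Nm).
Qed.

Section Frame.
Context {T : Type} {n : nat}.
Variables (a : T) (f : 'I_n -> T) (b : T).

Definition frame (i : 'I_n.+2) : T :=
  if unlift ord0 i is Some j then
    if unlift ord_max j is Some k then f k else b
  else a.

Lemma frame_first : frame ord0 = a.
Proof. by rewrite /frame unlift_none. Qed.

Lemma frame_last : frame (lift ord0 ord_max) = b.
Proof. by rewrite /frame liftK unlift_none. Qed.

Lemma frame_inner k : frame (lift ord0 (lift ord_max k)) = f k.
Proof. by rewrite /frame !liftK. Qed.

End Frame.

Lemma framed_word y z m n (X : 'I_n -> A) (h : 'I_n -> nat) :
  exch_emb E m y * (\prod_(i < n) exch_emb E (h i) (X i)) * exch_emb E m z =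
  \prod_(i < n.+2) exch_emb E (frame m h m i) (frame y X z i).
Proof.
rewrite big_ord_recl big_ord_recr /= !frame_first !frame_last mulrA.
congr (_ * _ * _); apply: eq_bigr => k _.
have -> : widen_ord (leqnSn n) k = lift ord_max k.
  by apply: val_inj; rewrite /= /bump leqNgt ltn_ord.
by rewrite !frame_inner.
Qed.

(** Surrounding the word by two letters of the unused colour [N] keeps its
    positions separated from the rest. *)
Lemma far_form_alternating y N n (X : 'I_n -> A) (h : 'I_n -> nat) :
  noncrossing_system E -> extended_weak_singleton E -> (0 < n)%N ->
  (forall i, null E (X i)) ->
  (forall i j : 'I_n, j = i.+1 :> nat -> h i <> h j) ->
  (forall i, (h i < N)%N) ->
  far_form y N (\prod_(i < n) exch_emb E (h i) (X i)) = 0.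
Proof.
move=> ncE ews n0 nX alt hN.
have inner (i : 'I_n.+2) : (1 <= i < n.+1)%N ->
    exists k, i = lift ord0 (lift ord_max k).
  case: (unliftP ord0 i) => [j|] -> //.
  case: (unliftP ord_max j) => [k|] -> //; first by exists k.
  by rewrite lift0 /= ltnn.
rewrite /far_form -exch_emb_star framed_word.
apply: (@separated_moment _ _ _ E _ _ _ 1 n.+1) => //.
  by rewrite !ltnS n0 /=.
  by move=> i /inner[k ->]; rewrite frame_inner.
move=> i j /inner[k ->]; rewrite frame_inner.
case: (unliftP ord0 j) => [{}j|] ->; last first.
  by rewrite frame_first => _ e; have := hN k; rewrite e ltnn.
case: (unliftP ord_max j) => [l|] ->; last first.
  by rewrite frame_last => _ e; have := hN k; rewrite e ltnn.
rewrite frame_inner !lift0 !lift_max !ltnS leq0n ltn_ord orbF => /eqP[].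
exact: alt.
Qed.

End Admissible.

Section AsymptoticStates.
Context {R : realType} {A : preCstarType R[i]} {phi : A -> R[i]}.
Variable E : exchangeability_system phi.
Hypotheses (ncE : noncrossing_system E) (ews : extended_weak_singleton E).

(** The limit of the compressions of the state by the copies of [y]. It is
    exchangeable because a permutation [s] carries the compression by the [m]-th
    copy to the compression by the [s m]-th copy, and both copies can be taken
    remote. *)
Lemma asymptotic_state y : phi (star y * y) != 0 ->
  exists2 w : E -> R[i], admissible w &
    forall u N, fixed_beyond N u -> w u = far_form y N u / phi (star y * y).
Proof.
move=> y0; pose f m (u : E) : R[i] := far_form y m u / phi (star y * y).
have fs m : state (f m).
  have c1 : exch_state (star (exch_emb E m y) * exch_emb E m y) =
      phi (star y * y).
    by rewrite -(far_form1 E y m) /far_form mulr1.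
  have := @state_compress _ E _ (exch_state_is_state E) (exch_emb E m y).
  by rewrite c1 => /(_ y0).
have fev N m u : fixed_beyond N u -> (N <= m)%N -> f m u = f N u.
  by move=> uN Nm; rewrite /f (far_form_eventually y uN Nm).
have [|w ws wf] := state_limit fs (local_dense E).
  by move=> u [N uN]; exists N => m; exact: fev.
have {}wf u N : fixed_beyond N u -> w u = f N u.
  by move=> uN; apply: wf => m; exact: fev.
exists w => //; split=> //.
- move=> n X h s sb.
  set u := \prod_(i < n) _; set v := \prod_(i < n) _.
  have uv : exch_act E s u = v.
    by rewrite rmorph_prod; apply: eq_bigr => i _; rewrite /= exch_act_emb.
  have [M uM] : local_elements u by exact: local_word.
  have [N vN] : local_elements v by exact: local_word.
  (* Only finitely many numbers are sent below [N] by [s]. *)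
  have [m Mm Nm] : exists2 m, (M <= m)%N & (N <= s m)%N.
    have [t ts st] := sb; pose P := \max_(k < N) t k.
    exists (maxn M P.+1); first exact: leq_maxl.
    rewrite leqNgt; apply/negP => sN.
    have := leq_bigmax (F := fun k : 'I_N => t k) (Ordinal sN).
    by rewrite /= ts -/P leqNgt leq_maxr.
  rewrite (wf _ _ (fixed_beyond_le Mm uM)) (wf _ _ (fixed_beyond_le Nm vN)).
  by rewrite /f (far_form_act _ _ _ sb) uv.
- move=> n X h n0 nX alt; have [N uN] := local_word E X h.
  pose M := maxn N (\max_(i < n) (h i).+1).
  rewrite (wf _ M) /f; last by apply: fixed_beyond_le uN; exact: leq_maxl.
  rewrite far_form_alternating ?mul0r// => i; apply: leq_trans (leq_maxr _ _).
  exact: (leq_bigmax (F := fun i : 'I_n => (h i).+1) i).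
Qed.

(** Up to normalization, the asymptotic states take the values [b y y] of a
    quadratic form at the copy of [X]; it polarizes to the sesquilinear form
    [b y z], whose value [b X 1] is the moment that has to vanish. Faithfulness
    settles the case of [y] with vanishing norm, where there is no normalized
    compression. *)
Lemma null_of_admissible X : faithful (@exch_state _ _ _ E) ->
  (forall w : E -> R[i], admissible w -> w (exch_emb E 0%N X) = 0) -> null E X.
Proof.
move=> faith wX.
pose b y z := exch_state
  (star (exch_emb E 1%N y) * exch_emb E 0%N X * exch_emb E 1%N z).
have b0 y : b y y = 0.
  have [y0|y0] := eqVneq (phi (star y * y)) 0.
    suff y1 : exch_emb E 1%N y = 0.
      by rewrite /b y1 mulr0 (state0 (exch_state_is_state E)).
    by apply: faith; rewrite -exch_emb_star -rmorphM exch_emb_state.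
  have [w wa wf] := asymptotic_state y0.
  have := wf _ _ (@fixed_beyond_emb _ _ _ E 0 X); rewrite wX// => /esym/eqP.
  by rewrite mulf_eq0 invr_eq0 (negPf y0) orbF => /eqP.
have es := exch_state_is_state E.
have bDl y y' z : b (y + y') z = b y z + b y' z.
  by rewrite /b rmorphD/= starD !mulrDl (stateD es).
have bDr y z z' : b y (z + z') = b y z + b y z'.
  by rewrite /b rmorphD/= mulrDr (stateD es).
have bZl c y z : b (c *: y) z = c^* * b y z.
  by rewrite /b linearZ/= starZ -!scalerAl (stateZ es).
have bZr c y z : b y (c *: z) = c * b y z.
  by rewrite /b linearZ/= -!scalerAr (stateZ es).
have h1 := b0 (X + 1); have h2 := b0 (X + 'i *: 1).
rewrite !bDl !bDr !b0 add0r addr0 in h1.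
rewrite !bDl !bDr !bZl !bZr !b0 !mulr0 add0r addr0 conjCi mulNr -mulrBr in h2.
move/eqP: h2; rewrite mulf_eq0 (negPf (neq0Ci _)) subr_eq0 => /eqP h2.
have : b X 1 = 0.
  by move/eqP: h1; rewrite -h2 -mulr2n mulrn_eq0 => /eqP.
rewrite /b /null rmorph1 mulr1 -(exch_act_state (transpose_bij 0 1)).
rewrite rmorphM/= exch_act_star ?exch_act_emb//; exact: transpose_bij.
Qed.

End AsymptoticStates.

(** * The embedding *)

Theorem theorem1p18 (R : realType) (A : preCstarType R[i]) (phi : A -> R[i])
    (E : exchangeability_system phi) :
  state phi ->
  noncrossing_system E ->
  faithful (@exch_state _ _ _ E) ->
  extended_weak_singleton E ->
  exists (Ut : preCstarType R[i]) (B : set Ut) (psi : {linear Ut -> Ut})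
         (beta : Ut -> R[i]) (j : {lrmorphism E -> Ut}),
    let iota k x := j (exch_emb E k x) in
    [/\ conditional_expectation B psi,
        injective j /\ (forall u, j (star u) = star (j u)),
        state_on B beta /\ (forall u, beta (psi (j u)) = exch_state u),
        interchangeable iota psi
      & free_with_amalgamation iota psi].
Proof.
move=> _ ncE faith ews.
pose I := {w : E -> R[i] | admissible w}.
pose i0 : I := exist _ _ (exch_state_admissible ncE ews).
pose w (i : I) : E -> R[i] := sval i.
have wadm i : admissible (w i) := svalP i.
have ws i : state (w i) by case: (wadm i).
pose j : {lrmorphism E -> bounded_family E i0} := @family_cst R E I i0.
pose psi : {linear bounded_family E i0 -> bounded_family E i0} :=
  state_expectation ws.
have jprod n (X : 'I_n -> A) h : \prod_(i < n) j (exch_emb E (h i) (X i)) =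
    j (\prod_(i < n) exch_emb E (h i) (X i)) by rewrite rmorph_prod.
exists (bounded_family E i0), (range psi), psi,
  (fun f : bounded_family E i0 => w i0 (f i0)), j.
split.
- exact: conditional_expectation_states.
- split=> [u v uv|u]; last exact: family_ext.
  exact: (congr1 (fun f : bounded_family E i0 => f i0) uv).
- split=> [|u]; first exact: evaluation_state.
  rewrite -[LHS]/(w i0 (w i0 u *: 1)).
  by rewrite (stateZ (ws i0)) (state1 (ws i0)) mulr1.
- move=> n X h s sb; rewrite !jprod; apply: family_ext => i /=; congr (_ *: _).
  by case: (wadm i) => _ + _; apply.
- move=> n X h n0 X0 alt; rewrite jprod; apply: family_ext => i /=.
  case: (wadm i) => _ _ -> //; first by rewrite scale0r.
  move=> k; apply: null_of_admissible => // v va.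
  have := congr1 (fun f : bounded_family E i0 => f (exist _ v va)) (X0 k).
  by move=> /= /eqP; rewrite scaler_eq0 oner_eq0 orbF => /eqP.
Qed.
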